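(* Let $\mu_{\min}\ge0$ and $b\ge0$ be such that $\mu_{\min}\le 2b$. Then for any $h\ge0$ and any communication algorithm $\mathrm{Alg}$, there exists a graph $\mathcal G\in\Gamma_{\mu_{\min},b}$ in which every honest node $i$ has weight of honest neighbors $h(i)$ larger than $h$, and such that for every $r<1$, $\mathrm{Alg}$ is not $r$-robust on $\mathcal G$.
   Context: Graph setting: $\mathcal G$ is a finite undirected graph with symmetric nonnegative edge weights $w_{ij}=w_{ji}$, together with a partition of its nodes into honest nodes $\mathcal H$ and Byzantine nodes $\mathcal B$ (the partition is part of the data of $\mathcal G$). $n_{\mathcal H}(i)$, $n_{\mathcal B}(i)$ are the honest and Byzantine neighbors of $i$; $h(i)=\sum_{j\in n_{\mathcal H}(i)}w_{ij}$ and $b(i)=\sum_{j\in n_{\mathcal B}(i)}w_{ij}$. $\mathcal G_{\mathcal H}$ is the subgraph induced on $\mathcal H$, and $\mu_2(\mathcal G_{\mathcal H})$ is the second smallest eigenvalue (with multiplicity) of its weighted Laplacian (algebraic connectivity). $\Gamma_{\mu_{\min},b}$ is the class of such graphs with $\mu_2(\mathcal G_{\mathcal H})\ge\mu_{\min}$ and $\max_{i\in\mathcal H}b(i)\le b$. Communication algorithm: a (deterministic) protocol run on the network in finitely many synchronous rounds. Each honest node $i$ starts with a parameter $x_i\in\mathbb R^d$ ($d\ge1$), at each round sends to each neighbor a message determined by the protocol from the weighted network, $b$, its own initial parameter and the messages it has received so far, and finally outputs a vector $x_i^+\in\mathbb R^d$ determined by the same information. The set of Byzantine nodes is unknown to honest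 nodes: the protocol run by honest nodes cannot depend on which nodes are Byzantine. Byzantine nodes are omniscient, can collude, and can send arbitrary and different messages to each of their neighbors. $r$-robustness: for $r<1$, $\mathrm{Alg}$ is $r$-robust on $\mathcal G$ if, for any initial honest parameters $(x_i)_{i\in\mathcal H}\in(\mathbb R^d)^{\mathcal H}$ and any behavior of the Byzantine nodes, the honest outputs satisfy $$\frac1{|\mathcal H|}\sum_{i\in\mathcal H}\|x_i^+-\overline x_{\mathcal H}\|^2\le r\,\frac1{|\mathcal H|}\sum_{i\in\mathcal H}\|x_i-\overline x_{\mathcal H}\|^2,\qquad \overline x_{\mathcal H}=\frac1{|\mathcal H|}\sum_{i\in\mathcal H}x_i .$$ *)

(* Defs.v *)
(* Mathematical Components, with the abstract real numbers (realType) of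
   MathComp-Analysis. *)
From HB Require Import structures.
From mathcomp Require Import all_boot all_order all_algebra.
From mathcomp Require Import polyrcf reals.

Set Implicit Arguments.
Unset Strict Implicit.
Unset Printing Implicit Defensive.

Import Order.TTheory GRing.Theory Num.Theory.
Local Open Scope ring_scope.

(* Two nodes are linked by an edge exactly when their weight is positive;
   there are no self-loops. *)
Record network (R : realType) := Network {
  node :> finType;
  weight : node -> node -> R;
  weight_ge0 : forall i j, 0 <= weight i j;
  weight_sym : forall i j, weight i j = weight j i;
  weight_irr : forall i, weight i i = 0 }.

Definition neighbors (R : realType) (g : network R) (S : {set g}) (i : g) :
  {set g} := [set j in S | 0 < weight i j].

Definition weight_in (R : realType) (g : network R) (S : {set g}) (i : g) : R :=
  \sum_(j in neighbors S i) weight i j.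

Definition induced (R : realType) (g : network R) (S : {set g}) : network R :=
  @Network R {x : g | x \in S}
    (fun x y => weight (val x) (val y))
    (fun x y => weight_ge0 (val x) (val y))
    (fun x y => weight_sym (val x) (val y))
    (fun x => weight_irr (val x)).

(* Rows and columns are numbered by the enumeration of the nodes; the spectrum
   does not depend on it. *)
Definition laplacian (R : realType) (g : network R) : 'M[R]_#|g| :=
  \matrix_(i, j) (weight_in [set: g] (enum_val i) *+ (i == j)
                  - weight (enum_val i) (enum_val j)).

(* The real eigenvalues in nondecreasing order (rootsR is increasing), repeated
   according to their multiplicity in the characteristic polynomial. For a
   symmetric matrix, this is the whole spectrum. *)
Definition eigenvalues (R : realType) (n : nat) (A : 'M[R]_n) : seq R :=
  flatten [seq nseq (mup a (char_poly A)) a | a <- rootsR (char_poly A)].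

(* Only meaningful for networks with at least two nodes. *)
Definition mu2 (R : realType) (g : network R) : R :=
  (eigenvalues (laplacian g))`_1.

Record byz_graph (R : realType) := ByzGraph {
  net :> network R;
  honest : {set net} }.

Definition byzantine (R : realType) (G : byz_graph R) : {set G} := ~: honest G.

Definition honest_weight (R : realType) (G : byz_graph R) (i : G) : R :=
  weight_in (honest G) i.

Definition byz_weight (R : realType) (G : byz_graph R) (i : G) : R :=
  weight_in (byzantine G) i.

(* At least two honest nodes are required for the algebraic connectivity of the
   honest subgraph to make sense. As byz_weight is nonnegative, 0 is neutral
   for the maximum. *)
Definition Gamma (R : realType) (mu_min b : R) (G : byz_graph R) : Prop :=
  [/\ (1 < #|honest G|)%N,
      mu_min <= mu2 (induced (honest G)) &
      \big[Num.max/0]_(i in honest G) byz_weight i <= b].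

(* What a node has received so far, one item per past round: the message from
   each neighbor, and None for the nodes that are not neighbors. *)
Definition history (R : realType) (g : network R) (M : Type) :=
  seq {ffun g -> option M}.

(* A protocol sees the weighted network but not the set of honest nodes.
   - send g b i j x hist is the message of i to j after the receptions hist
     (whose size is the index of the current round), x being the initial
     parameter of i;
   - output g b i x hist is the final vector of i. *)
Record algorithm (R : realType) (d : nat) := Algorithm {
  message : Type;
  rounds : network R -> R -> nat;
  send : forall (g : network R) (b : R) (i j : g),
    'rV[R]_d -> history g message -> message;
  output : forall (g : network R) (b : R) (i : g),
    'rV[R]_d -> history g message -> 'rV[R]_d }.

Section Execution.
Variables (R : realType) (d : nat) (Alg : algorithm R d) (b : R).
Variables (G : byz_graph R) (x : G -> 'rV[R]_d).
(* byz t j i is the message of the Byzantine node j to i in round t. As Alg is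
   deterministic, quantifying over all such tables covers the adaptive
   strategies of omniscient and colluding Byzantine nodes. *)
Variable byz : nat -> G -> G -> message Alg.

(* The values of x and of received at Byzantine nodes never influence those of
   received at honest nodes. *)
Fixpoint received (t : nat) (i : G) : history G (message Alg) :=
  if t is s.+1 then
    rcons (received s i)
      [ffun j => if j \in neighbors [set: G] i then
                   Some (if j \in honest G then
                           send b j i (x j) (received s j)
                         else byz s j i)
                 else None]
  else [::].

Definition final (i : G) : 'rV[R]_d :=
  output b i (x i) (received (rounds Alg G b) i).

End Execution.

(* Squared Euclidean norm; the norm provided by MathComp-Analysis on 'rV[R]_d
   is the sup norm. *)
Definition sqnorm (R : realType) (d : nat) (v : 'rV[R]_d) : R :=
  \sum_(k < d) v 0 k ^+ 2.

Definition honest_mean (R : realType) (d : nat) (G : byz_graph R)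
    (x : G -> 'rV[R]_d) : 'rV[R]_d :=
  #|honest G|%:R^-1 *: \sum_(i in honest G) x i.

Definition mean_sqdist (R : realType) (d : nat) (G : byz_graph R)
    (y : G -> 'rV[R]_d) (c : 'rV[R]_d) : R :=
  #|honest G|%:R^-1 * \sum_(i in honest G) sqnorm (y i - c).

Definition robust (R : realType) (d : nat) (Alg : algorithm R d) (b r : R)
    (G : byz_graph R) : Prop :=
  forall (x : G -> 'rV[R]_d) (byz : nat -> G -> G -> message Alg),
    mean_sqdist (final b x byz) (honest_mean x)
      <= r * mean_sqdist x (honest_mean x).

(* Main.v *)
(** Take three interchangeable clusters, each made of two nodes joined by a
    heavy edge, clusters being pairwise joined by edges of weight [b], so that the
    honest subgraph has algebraic connectivity [2 b] whichever cluster is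
    Byzantine. Running the protocol on the double cover of this network that
    unrolls the triangle of clusters into a hexagon, with parameter 0 on one
    sheet and 1 on the other, every two consecutive clusters of the hexagon see
    a genuine execution in which the third cluster, Byzantine, simulates the
    rest. Robustness on the pairs lying in one sheet forces every node to output
    its own parameter; then, on a pair straddling the two sheets, the protocol
    does not reduce the variance at all. *)
Require Import Defs.
From mathcomp Require Import all_boot all_order all_algebra.
From mathcomp Require Import boolp reals polyrcf ring lra.

Set Implicit Arguments.
Unset Strict Implicit.
Unset Printing Implicit Defensive.

Import Order.TTheory GRing.Theory Num.Theory.
Local Open Scope ring_scope.

(** * Spectrum *)

(** Both lists are sorted, so it suffices to count the occurrences of each scalar: on either side
    this is its multiplicity as a root. *)
Lemma eigenvalues_split (R : realType) (n : nat) (A : 'M[R]_n) (s : seq R) :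
  sorted <=%R s -> char_poly A = \prod_(a <- s) ('X - a%:P) ->
  eigenvalues A = s.
Proof.
move=> s_sorted pE.
have p0 : char_poly A != 0 by rewrite monic_neq0// char_poly_monic.
have rootsE a : (a \in rootsR (char_poly A)) = root (char_poly A) a.
  by rewrite -(roots_on_rootsR p0) in_itv.
rewrite /eigenvalues; apply: le_sorted_eq => //.
  have : sorted <%R (rootsR (char_poly A)) by exact: sorted_roots.
  rewrite lt_sorted_pairwise le_sorted_pairwise.
  elim: (rootsR _) => //= a t IH /andP[/allP a_lt t_lt].
  rewrite pairwise_cat IH// andbT; apply/andP; split.
    apply/allrelP => x y /nseqP[-> _] /flattenP[u /mapP[c ct ->] /nseqP[-> _]].
    exact/ltW/a_lt.
  by elim: (mup _ _) => //= m ->; rewrite andbT all_nseq lexx orbT.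
apply/allP => x _ /=; apply/eqP.
rewrite count_flatten -map_comp sumnE big_map.
under eq_bigr do rewrite /= count_nseq /=.
rewrite -mu_prod_XsubC -pE.
have [xr|xNr] := boolP (x \in rootsR (char_poly A)).
  rewrite (bigD1_seq x)/= ?eqxx ?mul1n//; last exact: uniq_roots.
  by rewrite big1 ?addn0// => c /negPf ->.
rewrite big_seq big1 ?mupNroot -?rootsE// => c cr.
by case: eqP => [cx|//]; rewrite cx (negPf xNr) in cr.
Qed.

(** The rows of [V] are left eigenvectors: over polynomials, [V] times ['X - A] is a diagonal matrix
    times [V], and [\det V] cancels. *)
Lemma char_poly_eigenbasis (F : fieldType) (n : nat) (A V : 'M[F]_n)
    (lam : 'rV[F]_n) :
  \det V != 0 -> V *m A = diag_mx lam *m V ->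
  char_poly A = \prod_i ('X - (lam 0 i)%:P).
Proof.
move=> V0 VA.
have detV0 : \det (map_mx polyC V) != 0 by rewrite det_map_mx polyC_eq0.
apply: (mulfI detV0); rewrite /char_poly -det_mulmx /char_poly_mx.
rewrite mulmxBr mul_mx_scalar -map_mxM VA map_mxM -mul_scalar_mx -mulmxBl.
rewrite det_mulmx mulrC; congr (_ * _).
rewrite map_diag_mx -diag_const_mx -raddfB det_diag.
by apply: eq_bigr => i _; rewrite !mxE.
Qed.

(** [phi] replaces the numbering of the nodes by a convenient index type. The square of [chi] is a
    nonzero scalar matrix, so its rows form a basis of left eigenvectors. *)
Lemma char_poly_laplacian (R : realType) (g : network R) (T : finType)
    (phi : T -> g) (chi : T -> T -> R) (lam : T -> R) (c : R) :
  bijective phi -> c != 0 ->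
  (forall x z, \sum_y chi x y * chi y z = c *+ (x == z)) ->
  (forall x z,
    \sum_y chi x y * (weight_in [set: g] (phi y) *+ (y == z)
                      - weight (phi y) (phi z)) = lam x * chi x z) ->
  char_poly (laplacian g) = \prod_(x : T) ('X - (lam x)%:P).
Proof.
move=> phi_bij; have [psi phiK psiK] := phi_bij.
move=> c0 chi2 chiL.
have sumE (F : g -> R) : \sum_(i < #|g|) F (enum_val i) = \sum_y F (phi y).
  by rewrite -(big_enum_val F) /= (reindex phi)//; exact: onW_bij.
pose V : 'M[R]_#|g| := \matrix_(i, j) chi (psi (enum_val i)) (psi (enum_val j)).
pose D : 'rV[R]_#|g| := \row_i lam (psi (enum_val i)).
have VV : V *m V = c%:M.
  apply/matrixP => i j; rewrite !mxE.
  under eq_bigr do rewrite !mxE.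
  rewrite (sumE (fun y => chi (psi (enum_val i)) (psi y)
                          * chi (psi y) (psi (enum_val j)))).
  under eq_bigr do rewrite phiK.
  by rewrite chi2 (can_eq psiK) (inj_eq enum_val_inj).
rewrite (@char_poly_eigenbasis _ _ _ V D).
- under eq_bigr do rewrite mxE.
  rewrite -(big_enum_val (fun y => 'X - (lam (psi y))%:P)) /= (reindex phi).
    by apply: eq_bigr => y _; rewrite phiK.
  exact: onW_bij.
- have : \det V * \det V != 0 by rewrite -det_mulmx VV det_scalar expf_neq0.
  by rewrite mulf_eq0 orbb.
- apply/matrixP => i j; rewrite mul_diag_mx !mxE -chiL.
  under eq_bigr do rewrite !mxE -(inj_eq enum_val_inj).
  rewrite (sumE (fun y => chi (psi (enum_val i)) (psi y) *
    (weight_in [set: g] y *+ (y == enum_val j) - weight y (enum_val j)))).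
  by apply: eq_bigr => y _; rewrite phiK psiK (can2_eq phiK psiK).
Qed.

Lemma weight_inE (R : realType) (g : network R) (S : {set g}) (i : g) :
  weight_in S i = \sum_(j in S) weight i j.
Proof.
rewrite /weight_in; under eq_bigl do rewrite inE.
rewrite big_mkcondr; apply: eq_bigr => j _.
by have := weight_ge0 i j; rewrite le_eqVlt => /predU1P[<-|->//]; rewrite ltxx.
Qed.

(** * The double cover *)

Section Cover.
Variables (R : realType) (d : nat) (Alg : algorithm R d) (b : R).
Variable g : network R.
(* A node of the cover is a pair (e, i); the edge from i to j leads from the
   sheet e to the sheet e (+) u i j. *)
Variables (u : g -> g -> bool) (X : bool -> g -> 'rV[R]_d).

(** Each node of the cover runs the protocol as if the network were [g], taking its neighbor above
    [j] for [j] itself. *)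
Fixpoint cover_received (t : nat) (e : bool) (i : g) :
    history g (message Alg) :=
  if t is s.+1 then
    rcons (cover_received s e i)
      [ffun j => if j \in neighbors [set: g] i then
                   Some (send b j i (X (e (+) u i j) j)
                              (cover_received s (e (+) u i j) j))
                 else None]
  else [::].

Definition cover_final (e : bool) (i : g) : 'rV[R]_d :=
  output b i (X e i) (cover_received (rounds Alg g b) e i).

(** [lab] lifts [S] to the cover compatibly with the changes of sheet. A Byzantine [j] sends to [i]
    what the neighbor of [(lab i, i)] above [j] sends in the cover; it may thus play different lifts
    of itself to different neighbors. *)
Lemma final_cover (S : {set g}) (lab : g -> bool) :
  {in S &, forall i j, lab i (+) u i j = lab j} ->
  exists byz : nat -> g -> g -> message Alg, {in S, forall i,
    @final R d Alg b (ByzGraph S) (fun j => X (lab j) j) byz i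
      = cover_final (lab i) i}.
Proof.
move=> labP.
exists (fun s j i => send b j i (X (lab i (+) u i j) j)
                       (cover_received s (lab i (+) u i j) j)) => i iS.
congr output; move: (rounds _ _ _) => t.
elim: t i iS => //= t IH i iS; rewrite IH//; congr rcons.
apply/ffunP => j; rewrite !ffunE; case: ifP => // _.
by case: ifP => // jS; rewrite IH// labP.
Qed.

End Cover.

(** * Robustness *)

Lemma mean_sqdist_le0 (R : realType) (d : nat) (G : byz_graph R)
    (y : G -> 'rV[R]_d) (c : 'rV[R]_d) :
  mean_sqdist y c <= 0 -> {in honest G, forall i, y i = c}.
Proof.
have sq_ge0 (v : 'rV[R]_d) : 0 <= sqnorm v.
  by apply: sumr_ge0 => k _; exact: sqr_ge0.
move=> le0 i iH.
have card_gt0 : 0 < #|honest G|%:R :> R.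
  by rewrite ltr0n; apply/card_gt0P; exists i.
move: le0; rewrite /mean_sqdist pmulr_rle0 ?invr_gt0// => le0.
have /eqP : \sum_(i in honest G) sqnorm (y i - c) = 0.
  by apply/eqP; rewrite eq_le le0 sumr_ge0.
rewrite psumr_eq0// => /allP/(_ i (mem_index_enum i)); rewrite iH /=.
rewrite psumr_eq0 => [/allP sq0|k _]; last exact: sqr_ge0.
apply/rowP => k; have := sq0 k (mem_index_enum k).
by rewrite /= sqrf_eq0 !mxE subr_eq0 => /eqP.
Qed.

(** The initial variance is zero, hence so is the bound, whatever [r]. *)
Lemma robust_consensus (R : realType) (d : nat) (Alg : algorithm R d) (b r : R)
    (G : byz_graph R) (x : G -> 'rV[R]_d)
    (byz : nat -> G -> G -> message Alg) (c : 'rV[R]_d) :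
  robust Alg b r G -> {in honest G, forall i, x i = c} ->
  {in honest G, forall i, final b x byz i = c}.
Proof.
move=> rob xc i iH.
have card_neq0 : #|honest G|%:R != 0 :> R.
  by rewrite pnatr_eq0 -lt0n; apply/card_gt0P; exists i.
have mean_c : honest_mean x = c.
  rewrite /honest_mean (eq_bigr (fun=> c)) // sumr_const -scaler_nat scalerA.
  by rewrite mulVf ?scale1r.
have := rob x byz; rewrite mean_c => le; apply: mean_sqdist_le0 iH.
apply: le_trans le _; rewrite [X in r * X](_ : _ = 0) ?mulr0//.
rewrite /mean_sqdist big1 ?mulr0// => j jH; rewrite xc// subrr.
by rewrite /sqnorm big1// => k _; rewrite mxE expr0n.
Qed.

(** The variance [V] of the parameters satisfies [V <= r * V] with [r < 1], so it vanishes. *)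
Lemma robust_fixed (R : realType) (d : nat) (Alg : algorithm R d) (b r : R)
    (G : byz_graph R) (x : G -> 'rV[R]_d)
    (byz : nat -> G -> G -> message Alg) :
  robust Alg b r G -> r < 1 -> {in honest G, forall i, final b x byz i = x i} ->
  {in honest G &, forall i j, x i = x j}.
Proof.
move=> rob r1 fix_x.
have le0 : mean_sqdist x (honest_mean x) <= 0.
  have := rob x byz; rewrite {1}/mean_sqdist.
  under eq_bigr => i iH do rewrite fix_x//.
  by rewrite -/(mean_sqdist _ _); nra.
by move=> i j iH jH; rewrite !(mean_sqdist_le0 le0).
Qed.

(** * Three clusters *)

Lemma big_bool2 (T : Type) (idx : T) (op : Monoid.com_law idx)
    (F : bool * bool -> T) :
  \big[op/idx]_x F x = op (op (F (true, true)) (F (true, false)))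
                          (op (F (false, true)) (F (false, false))).
Proof.
transitivity (\big[op/idx]_e \big[op/idx]_s F (e, s));
  last by rewrite !big_bool.
by rewrite pair_bigA; apply: eq_bigr => -[].
Qed.

Section Prism.
Variables (R : realType) (w b : R) (w_ge0 : 0 <= w) (b_ge0 : 0 <= b).

(** A weighted triangular prism, the first coordinate being the cluster. Clusters are matched node
    to node, so that removing one of them costs each other node exactly [b]. *)
Definition prism_weight (i j : 'I_3 * bool) : R :=
  if i.1 == j.1 then w *+ (i.2 != j.2) else b *+ (i.2 == j.2).

Lemma prism_weight_ge0 i j : 0 <= prism_weight i j.
Proof. by rewrite /prism_weight; case: ifP => _; rewrite mulrn_wge0. Qed.

Lemma prism_weight_sym i j : prism_weight i j = prism_weight j i.
Proof. by rewrite /prism_weight eq_sym (eq_sym i.2). Qed.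

Lemma prism_weight_irr i : prism_weight i i = 0.
Proof. by rewrite /prism_weight !eqxx. Qed.

Definition prism : network R :=
  Network prism_weight_ge0 prism_weight_sym prism_weight_irr.

Definition prism_without (k : 'I_3) : byz_graph R :=
  @ByzGraph R prism [set i | i.1 != k].

Lemma prism_honest_weight (k : 'I_3) (i : prism) :
  i \in honest (prism_without k) ->
  w <= @honest_weight R (prism_without k) i.
Proof.
rewrite /honest_weight weight_inE inE => ik.
rewrite (bigD1 (i.1, ~~ i.2)) ?inE//= {1}/prism_weight eqxx /=.
by case: i.2 => /=; rewrite lerDl sumr_ge0// => j _; exact: prism_weight_ge0.
Qed.

Lemma prism_byz_weight (k : 'I_3) (i : prism) :
  i \in honest (prism_without k) -> @byz_weight R (prism_without k) i = b.
Proof.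
rewrite /byz_weight weight_inE inE => ik.
rewrite (bigD1 (k, i.2)) ?inE ?negbK//= {1}/prism_weight (negPf ik) eqxx /=.
rewrite big1 ?addr0// => -[l s]; rewrite !inE negbK /= => /andP[/eqP ->].
by rewrite xpair_eqE eqxx /prism_weight /= (negPf ik) eq_sym => /negPf ->.
Qed.

Definition honest_pair (k : 'I_3) (x : bool * bool) : prism :=
  (lift k (if x.1 then ord_max else ord0 : 'I_2), x.2).

Lemma honest_pairP k x : honest_pair k x \in honest (prism_without k).
Proof. by rewrite inE eq_sym neq_lift. Qed.

Definition honest_node (k : 'I_3) (x : bool * bool) :
    induced (honest (prism_without k)) :=
  exist _ (honest_pair k x) (honest_pairP k x).

Lemma honest_node_bij k : bijective (honest_node k).
Proof.
pose f (y : induced (honest (prism_without k))) :=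
  (unlift k (val y).1 == Some ord_max, (val y).2).
exists f => [[e s]|[[l s] kl]]; rewrite /f /=.
  by rewrite liftK; case: e.
apply: val_inj; rewrite /honest_pair /=; move: kl; rewrite inE /= => kl.
congr pair; case: unliftP kl => [j ->|->]; last by rewrite eqxx.
by move=> _; congr lift; apply: val_inj; case: j => [[|[|]]].
Qed.

Lemma weight_honest_node k x y :
  weight (honest_node k x) (honest_node k y)
    = if x.1 == y.1 then w *+ (x.2 != y.2) else b *+ (x.2 == y.2).
Proof.
rewrite /= /prism_weight /= (inj_eq lift_inj).
by congr (if _ then _ else _); case: x.1; case: y.1.
Qed.

(* The eigenvectors are the characters of bool * bool, seen as (Z/2)^2. *)
Lemma prism_mu2 k : b <= w -> mu2 (induced (honest (prism_without k))) = 2 * b.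
Proof.
(* Two clusters form a 4-cycle, the Cartesian product of an edge of weight [b] and one of weight
   [w]: the eigenvalues of the factors add up. *)
move=> bw; pose lam (x : bool * bool) : R := 2 * b *+ x.1 + 2 * w *+ x.2.
have pE : char_poly (laplacian (induced (honest (prism_without k))))
    = \prod_(a <- [:: 0; 2 * b; 2 * w; 2 * b + 2 * w]) ('X - a%:P).
  pose chi (x y : bool * bool) : R :=
    (-1) ^+ (x.1 && y.1) * (-1) ^+ (x.2 && y.2).
  rewrite (@char_poly_laplacian _ _ _ (honest_node k) chi lam 4).
  - rewrite big_bool2.
    by rewrite !big_cons big_nil /lam /= !mulr0n !mulr1n !addr0 !add0r; ring.
  - exact: honest_node_bij.
  - by rewrite pnatr_eq0.
  - move=> [e s] [e' s']; rewrite big_bool2 /chi /=.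
    by case: e; case: s; case: e'; case: s' => //=; rewrite ?xpair_eqE /=; ring.
  - move=> x z.
    have degE y : weight_in [set: induced (honest (prism_without k))]
        (honest_node k y) = w + b.
      rewrite weight_inE (eq_bigl predT) => [|j]; last by rewrite inE.
      rewrite (reindex (honest_node k)); last exact/onW_bij/honest_node_bij.
      under eq_bigr do rewrite weight_honest_node.
      by rewrite big_bool2; case: y => [[] []] /=; ring.
    under eq_bigr do rewrite degE weight_honest_node.
    rewrite big_bool2 /chi /lam; case: x => [[] []]; case: z => [[] []] /=;
      rewrite ?xpair_eqE /=; ring.
(* Since [b <= w], the list is sorted and [2 * b] comes second. *)
rewrite /mu2 (eigenvalues_split _ pE)//=.
by rewrite ler_pM2l ?ltr0n// bw lerDr !(mulr_ge0 (ler0n R 2) b_ge0).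
Qed.

Lemma prism_Gamma k mu_min : mu_min <= 2 * b -> b <= w ->
  Gamma mu_min b (prism_without k).
Proof.
move=> hmu bw; split; last 1 first.
- by apply: bigmax_le => // i iH; rewrite prism_byz_weight.
- rewrite -[#|_|]/#|honest (prism_without k)|.
  apply: (@leq_trans #|[set honest_pair k (true, true);
                           honest_pair k (true, false)]|).
    by rewrite cards2 /honest_pair xpair_eqE andbF.
  apply/subset_leq_card/subsetP => i; rewrite in_set2.
  by case/orP => /eqP ->; exact: honest_pairP.
- by rewrite prism_mu2.
Qed.

(* The sheet changes only along the edges between the clusters 0 and 2, so that
   one lap around the triangle of clusters leads to the other sheet. *)
Definition prism_voltage (i j : prism) : bool :=
  [&& i.1 != 1, j.1 != 1 & i.1 != j.1].

End Prism.
Arguments prism_voltage {R w b w_ge0 b_ge0}.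

Theorem theorem3p5 (R : realType) (d : nat) (hd : (0 < d)%N)
    (mu_min b : R) (hmu : 0 <= mu_min) (hb : 0 <= b) (hmub : mu_min <= 2 * b)
    (h : R) (hh : 0 <= h) (Alg : algorithm R d) :
  exists G : byz_graph R,
    [/\ Gamma mu_min b G,
        forall i : G, i \in honest G -> h < honest_weight i &
        forall r : R, r < 1 -> ~ robust Alg b r G].
Proof.
apply: contrapT => noG.
(* Exceeds [h] for the honest weights, and [b] for the algebraic connectivity. *)
pose w := h + b + 1.
have w0 : 0 <= w by rewrite /w; lra.
have bw : b <= w by rewrite /w; lra.
have hw : h < w by rewrite /w; lra.
have rob k : exists2 r : R, r < 1 & robust Alg b r (prism_without w0 hb k).
  apply: contrapT => nrob; apply: noG; exists (prism_without w0 hb k); split.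
  - exact: prism_Gamma.
  - by move=> i /prism_honest_weight; apply: lt_le_trans.
  - by move=> r r1 rr; apply: nrob; exists r.
pose g := prism w0 hb.
pose X (e : bool) (i : g) : 'rV[R]_d := const_mx e%:R.
pose out := @cover_final R d Alg b g prism_voltage X.
(* The remaining clusters are 0 and 1, or 1 and 2: no edge there changes sheet, so a constant lift
   works and all honest parameters agree. *)
have out_pair k e : k != 1 ->
    {in [set i : g | i.1 != k], forall i, out e i = X e i}.
  move=> k1 i ik.
  have [r _ /robust_consensus rr] := rob k.
  have [|byz finalE] := @final_cover R d Alg b g prism_voltage X
      [set i : g | i.1 != k] (fun=> e).
    move=> [a s] [c t]; rewrite !inE /prism_voltage /=.
    by case: e; case: k k1 {ik rr} a c
      => [[|[|[|]]] ?] // _ [[|[|[|]]] ?] // [[|[|[|]]] ?].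
  by rewrite /out -finalE//; apply: rr ik.
have outE e i : out e i = X e i.
  have [i0|i0] := eqVneq i.1 0; last by apply: (out_pair 0); rewrite // inE.
  by apply: (out_pair 2%:R); rewrite // inE i0.
(* With cluster 1 Byzantine, the edges between 0 and 2 do change sheet: cluster 0 is lifted to the
   sheet of parameter 1 and cluster 2 to that of parameter 0. *)
pose lab (i : g) := i.1 == 0.
have [|byz finalE] := @final_cover R d Alg b g prism_voltage X
    [set i : g | i.1 != 1] lab.
  move=> [a s] [c t]; rewrite !inE /prism_voltage /lab /=.
  by case: a c => [[|[|[|]]] ?] // [[|[|[|]]] ?].
have [r r1 rr] := rob 1.
have fixed : {in [set i : g | i.1 != 1], forall i,
    final b (fun j : prism_without w0 hb 1 => X (lab j) j) byz i = X (lab i) i}.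
  by move=> i iH; rewrite finalE// -/(out _ _) outE.
(* Comparing a node of cluster 0 with one of cluster 2, on a coordinate that exists as [0 < d],
   gives [1 = 0]. *)
have := robust_fixed rr r1 fixed; move=> /(_ (0, true) (2%:R, true)).
rewrite !inE => /(_ isT isT) /rowP/(_ (Ordinal hd))/eqP.
by rewrite !mxE oner_eq0.
Qed.
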